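(* There exists a 3-regular matchstick graph of girth 5 with exactly 54 vertices.
   Context: A matchstick graph is a planar unit-distance graph: a finite graph embedded in the Euclidean plane such that every edge is drawn as a straight line segment of length 1 and no two edges intersect or touch except at a common endpoint. A graph is 3-regular if every vertex has degree 3. The girth of a graph is the length of a shortest cycle contained in the graph. *)

(* Defs.v *)
From mathcomp Require Import all_boot all_order all_algebra.
From mathcomp Require Import reals.

Set Implicit Arguments.
Unset Strict Implicit.
Unset Printing Implicit Defensive.

Import Order.TTheory GRing.Theory Num.Theory.

Local Open Scope ring_scope.

Section Graphs.
Variables (T : finType) (e : rel T).

Definition simple_graph : Prop := symmetric e /\ irreflexive e.

Definition degree (x : T) : nat := #|[set y | e x y]|.

Definition regular (k : nat) : Prop := forall x, degree x = k.

(* [ucycle] also accepts the empty sequence and, for a simple graph, the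
   back-and-forth walk [:: x; y]; cycles of a graph have length at least 3. *)
Definition graph_cycle (c : seq T) : Prop := ucycle e c /\ (2 < size c)%N.

(* A relation rather than a nat-valued function, since a forest has no girth. *)
Definition has_girth (g : nat) : Prop :=
  (exists2 c, graph_cycle c & size c = g) /\
  (forall c, graph_cycle c -> (g <= size c)%N).

End Graphs.

Section Matchstick.
Variable R : realType.

(* The library norm on 'rV[R]_2 is the max norm, hence this definition. *)
Definition edist (a b : 'rV[R]_2) : R :=
  Num.sqrt (\sum_(i < 2) (a 0 i - b 0 i) ^+ 2).

Definition in_segment (a b z : 'rV[R]_2) : Prop :=
  exists2 t : R, 0 <= t <= 1 & z = (1 - t) *: a + t *: b.

Variables (T : finType) (e : rel T).

(* Edges are unordered, so two edges xy and uv are distinct when the sets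
   {x, y} and {u, v} are. The fourth clause is implied by the others for
   vertices of positive degree; it keeps isolated vertices off the edges. *)
Definition matchstick_drawing (p : T -> 'rV[R]_2) : Prop :=
  [/\ injective p,
      forall x y, e x y -> edist (p x) (p y) = 1,
      forall x y u v, e x y -> e u v -> [set x; y] != [set u; v] ->
        forall z, in_segment (p x) (p y) z -> in_segment (p u) (p v) z ->
        exists2 w, w \in [set x; y] :&: [set u; v] & z = p w
    & forall x y w, e x y -> in_segment (p x) (p y) (p w) ->
        w \in [set x; y]].

Definition matchstick_graph : Prop :=
  simple_graph e /\ exists p, matchstick_drawing p.

End Matchstick.

(* Main.v *)
(* A numerical search among cubic plane graphs of girth 5 with a half-turn
   symmetry found a combinatorial type and approximate coordinates.  Let the
   half-turn act, so that 27 of the 54 points and 41 squared lengths determine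
   the drawing, and let c be the approximate configuration, J the Jacobian of
   the squared lengths at c and B a rational approximation of a right inverse
   of J.  As squared lengths are quadratic, u |-> u - (length^2 (c + B u) - 1) is
   explicitly a contraction of a small sup-norm ball of R^41; its fixed point
   is an exact unit-distance drawing within 17/10^5 of c in each coordinate.
   Orientation tests with that error margin then show that edges meet only in
   common endpoints. *)
From Stdlib Require Import ZArith.
From HB Require Import structures.
Require Import Defs.
From mathcomp Require Import all_boot all_order all_algebra.
From mathcomp Require Import all_classical all_reals all_analysis.
From mathcomp Require Import ring lra zify ssrZ.

Set Implicit Arguments.
Unset Strict Implicit.
Unset Printing Implicit Defensive.

Import Order.TTheory GRing.Theory Num.Theory numFieldNormedType.Exports.

(** * Systems of quadratic equations near an approximate solution *)

Section QuadraticSystems.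
Local Open Scope ring_scope.

(** Joins the completeness of matrices to their normed module structure, as Banach's fixed point
    theorem requires. *)
HB.instance Definition _ (R : realType) (m n : nat) := Complete.on 'M[R]_(m, n).

Lemma ler_mx_normP (R : realType) n (x : 'rV[R]_n) (b : R) : 0 <= b ->
  (`|x| <= b) <-> (forall i, `|x 0 i| <= b).
Proof.
move=> b0; rewrite [`|x|]mx_normrE; split=> [xb i|xb].
  by rewrite (le_trans _ xb)// (le_bigmax _ (fun p => `|x p.1 p.2|) (0, i)).
by apply/bigmax_leP; split=> // -[i j] _ /=; rewrite (ord1 i).
Qed.

(** Newton's method with a frozen, preconditioned derivative. [D] is meant to be the derivative of
    the gaps [g] composed with an approximate right inverse, so that the entries
    [\sum_d 2 * g i d * D i d j] nearly form the identity matrix. In the contraction hypothesis the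
    first sum measures the defect of row i from the identity, and the second term bounds the
    quadratic part on the ball of radius r. The last hypothesis bounds the residual at 0, which
    keeps the ball stable. *)
Lemma sum_sqr_system_solvable (R : realType) n (I : finType)
    (g : 'I_n -> I -> R) (D : 'I_n -> I -> 'I_n -> R) (q r : R) :
    0 <= q < 1 -> 0 <= r ->
    (forall i, \sum_j `|(i == j)%:R - \sum_d 2 * g i d * D i d j|
      + 2 * r * \sum_d (\sum_j `|D i d j|) ^+ 2 <= q) ->
    (forall i, `|\sum_d g i d ^+ 2 - 1| <= (1 - q) * r) ->
  exists2 u : 'I_n -> R, (forall j, `|u j| <= r) &
    forall i, \sum_d (g i d + \sum_j D i d j * u j) ^+ 2 = 1.
Proof.
move=> /andP[q0 q1] r0 contr init.
pose l i d (u : 'rV[R]_n) := \sum_j D i d j * u 0 j.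
have lB i d u v : l i d (u - v) = l i d u - l i d v.
  by rewrite -sumrB; apply: eq_bigr => j _; rewrite !mxE mulrBr.
have lD i d u v : l i d (u + v) = l i d u + l i d v.
  by rewrite -big_split; apply: eq_bigr => j _; rewrite !mxE mulrDr.
have l_le i d u b : 0 <= b -> `|u| <= b -> `|l i d u| <= (\sum_j `|D i d j|) * b.
  move=> b0 /(ler_mx_normP _ b0) ub.
  rewrite (le_trans (ler_norm_sum _ _ _))// mulr_suml ler_sum// => j _.
  by rewrite normrM ler_wpM2l.
pose T (u : 'rV[R]_n) : 'rV[R]_n :=
  \row_i (u 0 i - (\sum_d (g i d + l i d u) ^+ 2 - 1)).
pose U : set 'rV[R]_n := [set u | `|u| <= r]%classic.
have T_lip u v : U u -> U v -> `|T u - T v| <= q * `|u - v|.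
  move=> ur vr; apply/ler_mx_normP => [|i]; first by rewrite mulr_ge0.
  (* By the difference of squares, the quadratic part of the increment is exactly a sum of products
     [l i d (u + v) * l i d (u - v)]. *)
  have -> : (T u - T v) 0 i =
      \sum_j ((i == j)%:R - \sum_d 2 * g i d * D i d j) * (u - v) 0 j
      - \sum_d l i d (u + v) * l i d (u - v).
    under [X in _ = X - _]eq_bigr do rewrite mulrBl mulr_suml.
    rewrite sumrB [X in _ = _ - X - _]exchange_big /= (bigD1 i)//= eqxx mul1r.
    rewrite [X in _ + X - _ - _]big1 ?addr0; last first.
      by move=> j /negbTE; rewrite eq_sym => ->; rewrite mul0r.
    rewrite -addrA -opprD -big_split /= !mxE.
    have -> : \sum_d (\sum_j 2 * g i d * D i d j * (u - v) 0 j
                + l i d (u + v) * l i d (u - v))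
        = \sum_d (g i d + l i d u) ^+ 2 - \sum_d (g i d + l i d v) ^+ 2.
      rewrite -sumrB; apply: eq_bigr => d _.
      under eq_bigr do rewrite -mulrA.
      by rewrite -mulr_sumr -/(l i d (u - v)) lB lD; ring.
    by ring.
  rewrite (le_trans (ler_normB _ _))//.
  apply: le_trans (ler_wpM2r (normr_ge0 _) (contr i)); rewrite mulrDl lerD//.
    rewrite (le_trans (ler_norm_sum _ _ _))// mulr_suml ler_sum// => j _.
    rewrite normrM ler_wpM2l//; exact: (ler_mx_normP _ (normr_ge0 _)).1.
  rewrite (le_trans (ler_norm_sum _ _ _))// mulr_sumr mulr_suml ler_sum// => d _.
  have uvr : `|u + v| <= 2 * r.
    by rewrite (le_trans (ler_normD _ _))// mulr2n mulrDl mul1r lerD.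
  rewrite normrM (le_trans (ler_pM _ _ (l_le _ _ _ _ _ uvr)
    (l_le _ _ _ _ _ (lexx _))))// ?mulr_ge0//.
  by rewrite le_eqVlt; apply/orP; left; apply/eqP; ring.
have T0 : `|T 0| <= (1 - q) * r.
  apply/ler_mx_normP => [|i]; first by rewrite mulr_ge0// subr_ge0 ltW.
  rewrite !mxE sub0r normrN; under eq_bigr => d _.
    rewrite (_ : l i d 0 = 0) ?addr0; last by rewrite -(subrr 0) lB subrr.
    over.
  exact: init.
have U0 : U 0 by rewrite /U /= normr0.
(* [T u] lies within q * r of [T 0], which lies within (1 - q) * r of 0. *)
have TU : set_fun U U T.
  move=> u ur; rewrite /U /= -(subrK (T 0) (T u)).
  rewrite (le_trans (ler_normD _ _))// -[leRHS]mul1r -(subrKC q 1) mulrDl.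
  by rewrite lerD// (le_trans (T_lip _ _ ur U0))// subr0 ler_wpM2l.
pose f := mkfun_fun TU.
have fc : is_contraction f.
  exists (NngNum q0); split => //= -[u v] [/= ur vr]; exact: T_lip.
have closedU : closed U.
  apply: (@closed_comp _ _ (fun u : 'rV[R]_n => `|u|) [set x | x <= r]%classic).
    by move=> u _; exact: norm_continuous.
  exact: closed_le.
have [u ur fixu] := banach_fixed_point fc closedU (ex_intro _ 0 U0).
exists (fun j => u 0 j) => [j|i]; first exact: (ler_mx_normP _ r0).1.
have := congr1 (fun x : 'rV[R]_n => x 0 i) fixu.
rewrite mxE => /eqP; rewrite -subr_eq0 opprB addrCA subrr addr0 subr_eq0.
by move/eqP.
Qed.

End QuadraticSystems.

(** * The graph and its approximate drawing *)

(* Edges modulo the half-turn: vertices 0, ..., 26 represent the orbits and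
   v + 27 is the antipode of v. *)
Definition link : seq (nat * nat) := [::
   (0, 1); (0, 2); (0, 27); (1, 3); (1, 4); (2, 5); (2, 6); (3, 7); (3, 32);
   (4, 6); (4, 8); (5, 9); (6, 10); (7, 11); (7, 12); (8, 11); (8, 13);
   (9, 10); (9, 14); (10, 15); (11, 16); (12, 17); (12, 18); (13, 19);
   (13, 20); (14, 21); (14, 44); (15, 21); (15, 46); (16, 18); (16, 20);
   (17, 22); (18, 23); (19, 24); (20, 25); (21, 26); (22, 23); (22, 53);
   (23, 25); (24, 25); (24, 53)].

Section IntegerData.
Local Open Scope Z_scope.

Definition scale : Z := 100000.
Definition flex_scale : Z := 100.

(* Radius of the ball for the contraction, in units of 1 / scale. *)
Definition flex_bound : Z := 5.

(* The resulting error on a coordinate, in units of 1 / scale. *)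
Definition tol : Z := 17.

(* Approximate coordinates, in units of 1 / scale. *)
Definition center : seq (Z * Z) := [::
   (-44512, -22774); (-117991, 45055); (-121164, 41448); (-35599, -11615);
   (-190750, 113657); (-54052, -32687); (-218258, 17515); (-89831, 72402);
   (-147929, 204025); (-140333, 17865); (-178881, -74406); (-182427, 110164);
   (-16514, 4398); (-54093, 238591); (-168710, -78024); (-116992, -152953);
   (-105289, 173801); (73056, 48862); (-86807, 75524); (44492, 221828);
   (-8229, 149729); (-69573, -64911); (7701, 124550); (-572, 24893);
   (5972, 129545); (-82289, 82533); (-101303, -159743)].

(* J^T (J J^T)^-1 times flex_scale, rounded: one row per coordinate and one
   column per entry of link. *)
Definition flex : seq (seq Z * seq Z) := [::
  ([::
    15; 7; -18; -10; 3; -4; 2; 7; -2; -4; -3; 1; -3; 1; -5; 2; -1; 1; 0; -2;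
    -2; 0; 5; -1; 1; 0; 0; 0; -2; 2; -2; 0; -2; 0; 1; 0; 0; 1; 1; -1; -1],
   [::
    -29; -15; -19; 19; -6; 8; -5; -15; 4; 7; 5; -3; 5; -2; 11; -4; 2; -1; 1;
    4; 4; 1; -9; 3; -2; 0; 0; 0; 3; -4; 3; 0; 4; -1; -2; 0; -1; -1; -2; 2; 2]);
  ([::
    -6; 5; 0; -28; 1; -3; 2; 21; -6; -4; -3; -1; -3; 2; -16; 3; -1; 0; 0; -2;
    -4; -1; 13; -2; 2; 0; -1; 0; -2; 5; -4; -1; -7; 0; 2; 0; 1; 1; 3; -3; -2],
   [::
    23; -17; 1; -1; -7; 10; -5; 1; 0; 7; 4; -5; 6; 0; -1; -2; 2; -1; 1; 4; 1;
    0; 0; 2; -1; 0; -1; -1; 3; -1; 1; 0; 0; -1; 0; 0; 0; 0; 0; 0; 0]);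
  ([::
    19; -21; -1; -10; 8; 0; 27; 8; -2; -29; -22; -1; -24; 4; -5; 13; -9; 5;
    -3; -17; -10; 1; 5; -12; 6; -1; 1; 2; -14; 6; -7; 0; -1; 4; 3; -1; 1; 2;
    0; -1; -3],
   [::
    -23; 29; 2; 19; 0; 13; 25; -13; 4; -23; -18; -5; -19; 1; 11; 9; -8; 5; -2;
    -14; -5; 2; -8; -10; 3; -1; 2; 2; -11; 0; -3; 0; 6; 4; 1; -1; 0; 0; -3; 2;
    0]);
  ([::
    -20; 15; 0; 30; 6; -9; 4; -2; -16; -6; -3; 0; -5; 0; 2; 2; -1; 1; -1; -3;
    -1; 0; -1; -2; 1; 0; 0; 0; -3; 0; -1; 0; 1; 1; 0; 0; 0; 0; -1; 0; 0],
   [::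
    3; -2; 0; -4; -1; 1; -2; -34; -15; 4; 4; -5; 3; -4; 25; -5; 1; 0; 1; 2; 6;
    2; -21; 2; -3; -1; 1; 0; 2; -8; 5; 1; 11; 0; -4; 0; -2; -2; -5; 5; 3]);
  ([::
    -16; 11; -1; -23; -42; -7; 0; 18; -5; 7; -23; 2; 4; 5; -13; 15; -5; -1; 1;
    1; -12; -1; 11; -4; 4; 0; -1; -1; -1; 8; -8; -1; -4; 0; 4; 1; 1; 2; 2; -4;
    -3],
   [::
    13; -11; 0; 5; 19; 5; -8; -3; 1; 18; -17; -2; 12; 2; 3; 10; -3; -3; 2; 7;
    -7; 0; -1; 0; 1; 0; -1; -1; 4; 2; -3; 0; 2; -1; 2; 1; 0; 0; -1; -1; -1]);
  ([::
    27; -26; -1; -29; -1; 24; -3; 20; -24; 2; 0; 3; 2; 2; -15; 1; 1; 0; 0; 1;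
    -3; -1; 12; 0; 1; 1; -1; 0; 1; 4; -3; -1; -7; -1; 2; 0; 1; 1; 3; -3; -2],
   [::
    -17; 25; 2; 2; -8; -33; -2; -3; -16; 5; 2; -1; 3; 0; 2; -1; 1; -1; 1; 2;
    1; 0; -2; 1; -1; 0; 0; 0; 2; -1; 1; 0; 1; 0; 0; 0; 0; 0; 0; 0; 0]);
  ([::
    12; -13; 0; -5; 6; 3; -18; 5; -1; -28; -23; -2; -34; 3; -2; 12; -10; 8;
    -4; -24; -9; 1; 3; -15; 6; -1; 2; 3; -19; 5; -7; 0; 0; 6; 3; -1; 1; 2; 0;
    0; -3],
   [::
    5; -4; 0; 0; 5; 2; -3; 1; 0; -24; -17; -1; 23; 2; 0; 11; -1; -6; 3; 14;
    -7; -1; 1; 3; 0; 0; -2; -3; 9; 3; -4; 0; 1; -3; 2; 1; 0; 0; 0; -3; -1]);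
  ([::
    6; -4; 0; -10; -2; 3; 1; 12; -2; -6; -9; -2; -5; 19; -27; 12; -1; 1; 0;
    -3; -16; -2; 23; -3; 5; 1; -1; 0; -3; 12; -11; -1; -10; 0; 6; 0; 2; 3; 6;
    -7; -5],
   [::
    19; -15; 0; -30; -6; 8; -3; 35; -6; 3; 0; -6; 3; 9; 7; 2; 1; -1; 1; 2; -3;
    0; -5; 1; 0; 0; 0; 0; 2; 0; -1; 0; 3; 0; 0; 0; 0; 0; -2; 0; 0]);
  ([::
    -1; 2; 0; 2; 2; 0; 4; -1; 0; -11; -9; 0; -13; 1; 1; 2; -38; 1; 0; -17; -3;
    0; 0; -29; 8; 0; 0; 1; -22; 2; -4; 0; 1; 9; 2; 0; 1; 2; -1; 1; -3],
   [::
    6; -6; 0; -7; -2; 1; -10; 6; -1; 26; 32; -1; 20; 4; -3; 17; 13; -4; 3; 16;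
    -11; -1; 4; 12; -1; 0; -1; -2; 14; 5; -5; 0; -1; -5; 3; 1; 0; 0; 1; -4; -1]);
  ([::
    29; -32; -1; -24; 3; 35; 1; 17; -12; -6; -4; -43; -6; 2; -13; 4; -1; 11;
    8; -1; -4; -2; 11; -1; 2; 0; -4; 0; -1; 4; -3; -1; -5; 0; 2; 0; 1; 1; 3;
    -3; -2],
   [::
    -12; 15; 1; 11; 0; -14; 4; -8; 5; -8; -6; 18; -10; 0; 6; 3; -2; 18; 14;
    -1; -1; -2; -5; -2; 1; -1; -5; 0; -1; -1; 0; -1; 3; 1; 0; 0; 0; 0; -2; 1;
    0]);
  ([::
    0; 0; 0; -1; -1; 0; -1; 1; 0; 2; 0; 0; 5; 0; -1; -2; -7; -26; 15; -31; 1;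
    -2; 0; -14; 4; -2; -5; 5; -22; 0; -1; -1; 0; 7; 0; -2; 1; 2; -1; 2; -1],
   [::
    0; 1; 0; 1; 2; 1; 5; -1; 0; -11; -8; 0; -15; 1; 1; 5; 1; -21; 12; 11; -3;
    -2; 0; 4; -1; 0; -4; -2; 7; 1; -1; -1; 1; -2; 1; 1; 0; 0; 0; -1; 0]);
  ([::
    0; 0; 0; 0; 0; 0; 0; 0; 0; 1; 2; 0; 0; -32; -27; -3; -1; -1; 1; 0; -17;
    -2; 23; -2; 5; 1; -2; -1; -1; 13; -11; -1; -10; -1; 7; 1; 2; 3; 6; -7; -5],
   [::
    5; -6; 0; -6; -1; 1; -8; 6; -1; 22; 28; -1; 15; 16; 7; -35; 0; -4; 2; 9;
    -6; 0; -5; 2; 0; 0; -1; -2; 6; 1; -2; 0; 3; -2; 1; 1; 0; 0; -2; -1; 0]);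
  ([::
    -4; 3; 0; 7; 1; -1; 1; -8; 1; -2; -2; 1; 0; 4; 14; 3; 0; -2; 5; -1; -4;
    -28; 10; -1; 2; 10; -20; -2; -1; 4; -3; -1; -5; 0; 2; -1; 1; 2; 3; -2; -2],
   [::
    8; -7; 0; -12; -3; 4; -4; 13; -2; 8; 8; -3; 7; -7; -23; -8; 2; -4; 6; 5;
    9; -28; -19; 3; -4; 10; -20; -3; 3; -8; 7; 0; 9; 0; -4; -1; -1; -2; -5; 5;
    4]);
  ([::
    0; 0; 0; 1; 1; 0; 1; -1; 0; -2; 2; 0; -7; 1; 2; 4; 14; -1; 1; -13; -1; 0;
    -2; -26; -4; 0; 0; 0; -19; 0; 2; 0; 1; 8; -3; 0; 0; 0; -2; 5; 0],
   [::
    4; -3; 0; -6; -1; 2; -1; 7; -1; 2; 1; -1; 3; 4; -5; 11; 16; 0; 0; 3; -15;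
    0; 8; 4; 31; 0; 0; -1; 4; 11; -22; -1; -1; -4; 17; 2; 1; 4; 2; -14; -8]);
  ([::
    2; -2; 0; -3; 0; 1; 0; 3; -1; 1; 0; -1; 1; -1; -4; 0; 0; -2; 4; -1; 0;
    -12; 0; 0; 0; -15; -25; 4; 0; 0; 0; -4; -1; 0; 1; 1; 2; 2; 0; -1; -2],
   [::
    -4; 6; 0; 5; 1; -4; 4; -3; 2; -10; -7; 5; -12; 1; 3; 4; -2; 22; -37; -1;
    -2; 1; -2; -2; 1; 4; 1; -1; -2; 1; -1; 0; 2; 1; 1; 0; 0; 0; -1; 0; 0]);
  ([::
    1; -1; 0; -2; -2; 0; -3; 2; 0; 6; 3; 0; 10; -1; -2; -4; -6; 1; 0; 16; 1;
    -2; 1; -13; 4; 7; -5; -26; -20; 0; -2; 0; -1; 7; 2; 14; 0; -1; 1; -2; -6],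
   [::
    0; 1; 0; 1; 1; 1; 3; 0; 0; -8; -5; 0; -11; 1; 0; 4; 1; 0; 0; -15; -3; -2;
    0; 5; 0; 7; -5; -27; 8; 1; -2; 0; 0; -2; 2; 14; -1; -2; 1; -4; -4]);
  ([::
    -1; 0; 0; 2; 1; -1; -2; -3; 0; 8; 11; 0; 4; -8; -3; -17; -3; -2; 1; 1; 23;
    -1; 1; -5; 10; 0; -1; -1; -1; -7; -23; -1; -4; -1; 13; 2; 1; 4; 3; -11; -7],
   [::
    7; -6; 0; -9; -2; 2; -6; 10; -2; 14; 16; -2; 10; -13; -22; -18; 2; -2; 2;
    8; 24; -1; 23; 5; -6; 0; -1; -1; 6; 24; 12; 0; -4; -1; -6; 0; 0; -1; 2; 3;
    3]);
  ([::
    -1; 0; 0; 2; 0; 0; -1; -2; 0; 2; 2; 0; 3; 1; 4; -1; 1; -4; 6; 2; 1; 9; -2;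
    1; -1; 12; -24; -3; 1; 0; 1; 14; 2; -1; -2; 0; -7; -6; 0; 3; 5],
   [::
    1; -1; 0; -2; 0; 1; 0; 2; 0; 0; -1; -1; 0; 0; -2; 1; -1; -2; 3; -1; -1; 9;
    5; -1; 2; 7; -13; -1; -1; 1; -2; -30; -5; 1; 4; -3; 15; 14; 0; -6; -10]);
  ([::
    -7; 5; 0; 12; 2; -3; 0; -14; 2; 3; 5; 2; 2; 1; 18; -6; 1; 0; 0; 2; 8; -1;
    -23; 2; -3; 0; -1; 0; 2; -15; 8; -1; -22; -1; -3; 0; 3; 2; 11; -3; -2],
   [::
    5; -5; 0; -7; -2; 2; -5; 8; -1; 13; 15; -1; 10; -11; -18; -16; 2; -2; 1;
    8; 22; -1; 19; 7; -9; 0; -1; -1; 7; -28; 18; 0; -7; -1; -9; 0; 0; -2; 4;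
    5; 4]);
  ([::
    -1; 1; 0; 3; 1; 0; 1; -3; 0; 0; 4; 0; -4; 0; 3; 1; 12; -1; 1; -10; 2; 0;
    -4; 25; -10; 0; 0; 0; -15; -3; 7; 0; 2; 13; -7; 0; 0; 0; -2; 9; 1],
   [::
    0; -1; 0; 0; -2; -1; -5; -1; 0; 14; 12; 0; 17; -2; 1; -7; 5; -1; 0; 22; 6;
    -1; -3; 9; -6; 0; -1; -1; 27; -4; 7; -1; 1; 23; -8; 1; 1; 1; -3; 13; -2]);
  ([::
    -2; 1; 0; 3; 1; -1; -2; -4; 1; 6; 8; 1; 4; -5; 1; -11; -1; -1; 1; 2; 16;
    -1; -3; -2; 7; 0; -1; -2; 1; -11; 23; -2; -4; -3; 21; 2; 2; 6; 3; -18; -11],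
   [::
    3; -3; 0; -5; -2; 1; -3; 6; -1; 6; 4; -1; 8; 1; -6; 3; 8; 0; 0; 11; -6; 0;
    7; 16; -19; 0; 0; -2; 14; 5; -11; -2; -4; -10; 29; 3; 2; 7; 4; -26; -14]);
  ([::
    1; -1; 0; -2; 0; 1; 0; 2; 0; 0; 0; 0; 0; -1; -4; 0; 0; 0; -1; 0; 0; -13;
    0; 0; 0; 37; -25; 2; 0; 0; 0; -5; -1; 0; 0; -2; 2; 2; 0; 0; -1],
   [::
    0; 1; 0; 1; 1; 0; 2; 0; 0; -4; -4; 0; -5; 1; 1; 2; -2; 0; 0; -7; -2; 3; 1;
    -2; 2; -9; 7; 15; -3; 1; -2; 2; 0; 1; 3; 22; -2; -4; 1; -5; -7]);
  ([::
    -2; 1; 0; 3; 0; -1; -1; -3; 0; 4; 5; 1; 4; -1; 4; -4; 2; -1; 1; 5; 5; 0;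
    -6; 4; -5; 1; -3; -3; 4; -3; 7; -10; 5; -3; -11; 5; -2; -38; -5; 19; 27],
   [::
    0; 0; 0; -1; 0; 0; -1; 1; 0; 1; 2; 0; 1; -1; -2; -1; 1; 1; -1; 1; 2; 1; 2;
    1; -2; -3; 5; 0; 1; -1; 3; 16; -3; -1; -4; 2; 18; -13; -4; 8; 10]);
  ([::
    -10; 8; 0; 15; 3; -4; 2; -17; 3; -4; -3; 3; -3; 6; 27; 3; 0; 1; -1; -1;
    -3; 0; -31; 0; 0; -1; 3; 0; -1; 0; -1; 7; 37; -1; 0; 2; -15; -7; 6; 0; 3],
   [::
    1; -1; 0; -2; 0; 0; -1; 2; 0; 2; 2; 0; 2; -2; -4; -2; 1; 0; -1; 2; 3; 0;
    4; 2; -2; -2; 5; -1; 2; -2; 3; 14; -6; -1; -5; 2; -31; -16; -5; 9; 12]);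
  ([::
    -2; 1; 0; 3; 1; -1; 0; -3; 0; 0; 1; 0; 0; 0; 3; -2; -1; 0; 0; -1; 3; 0;
    -4; -1; -3; 0; -1; -2; -2; -3; 5; -4; 3; 6; -11; 4; 5; 12; -6; 19; -24],
   [::
    0; -1; 0; 0; -1; -1; -5; -1; 0; 14; 14; 0; 15; -1; 1; -6; 11; -1; 1; 18;
    6; -1; -3; 20; -9; 0; 0; 0; 22; -4; 7; 1; 1; -29; -7; -1; -1; -4; -1; 9; 8]);
  ([::
    -5; 4; 0; 8; 1; -2; 0; -10; 2; 2; 3; 2; 3; 2; 15; -1; 2; 0; 0; 4; 2; 0;
    -18; 4; -3; 0; -1; -1; 5; -2; 4; -3; 20; -5; -7; 2; 5; 8; -26; -21; -13],
   [::
    7; -6; 0; -11; -3; 3; -5; 12; -2; 10; 10; -2; 9; -7; -21; -8; 4; -1; 1; 9;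
    9; 0; 23; 9; -8; 0; 0; -2; 9; -5; 10; 0; -30; -7; -14; 3; -2; 4; 36; -21;
    -11]);
  ([::
    2; -1; 0; -3; 0; 1; 1; 3; 0; -4; -4; -1; -3; 1; -4; 4; -2; 1; -1; -3; -5;
    1; 5; -5; 6; -2; 2; -3; -4; 4; -8; 4; -4; 3; 13; 7; -5; -11; 7; -23; -33],
   [::
    0; 1; 0; 1; 1; 0; 1; -1; 0; -3; -2; 0; -4; 0; 1; 1; -1; 0; 0; -6; 0; -1;
    -1; -1; 0; 4; -3; 17; -1; 0; 0; -1; 1; 0; -1; -34; 0; 0; -1; 3; 3])].

Definition antipode (v : nat) : nat := (if v < 27 then v + 27 else v - 27)%N.

(** The edge from 0 to 27 passes through the centre of the half-turn and is its own image. It is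
    therefore listed in both orientations, which makes 82 entries for 81 edges. *)
Definition edges : seq (nat * nat) :=
  link ++ [seq (antipode e.1, antipode e.2) | e <- link].

Definition dart : seq (nat * nat) := edges ++ [seq (e.2, e.1) | e <- edges].

(** A walk x, y, z is stored as ((x, y), z); the case x = z is included. *)
Definition path2 : seq (nat * nat * nat) :=
  [seq (e, f.2) | e <- dart, f <- [seq f <- dart | f.1 == e.2]].

(** Coordinates are indexed by [bool], a finite type, so that sums over d make sense; [true] is the
    ordinate. *)
Definition crd (T : Type) (d : bool) (x : T * T) : T := if d then x.2 else x.1.

Definition zpt (v : nat) : Z * Z :=
  if (v < 27)%N then nth (0, 0) center v
  else let: (x, y) := nth (0, 0) center (v - 27)%N in (- x, - y).

Definition zflex (v : nat) (d : bool) (j : nat) : Z :=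
  if (v < 27)%N then nth 0 (crd d (nth ([::], [::]) flex v)) j
  else - nth 0 (crd d (nth ([::], [::]) flex (v - 27)%N)) j.

Definition zgap (i : nat) (d : bool) : Z :=
  let e := nth (0, 0)%N link i in crd d (zpt e.1) - crd d (zpt e.2).

Definition zgap_flex (i : nat) (d : bool) (j : nat) : Z :=
  let e := nth (0, 0)%N link i in zflex e.1 d j - zflex e.2 d j.

(** A sum in a form that [vm_compute] evaluates; [zR_sum] turns it into a big operator. *)
Definition zsum (n : nat) (F : nat -> Z) : Z :=
  foldr (fun j t => F j + t) 0 (iota 0 n).

(* The hypotheses of [sum_sqr_system_solvable] for g / S, D / P, q = 1 / 2 and
   r = K / S, cleared of denominators. *)
Definition newton_check (n : nat) (S P K : Z) (g : nat -> bool -> Z)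
    (D : nat -> bool -> nat -> Z) : bool :=
  all (fun i =>
    (2 * P * zsum n (fun j => Z.abs ((if i == j then S * P else 0)
        - 2 * (g i true * D i true j + g i false * D i false j)))
      + 4 * K * (zsum n (fun j => Z.abs (D i true j))
                 * zsum n (fun j => Z.abs (D i true j))
               + zsum n (fun j => Z.abs (D i false j))
                 * zsum n (fun j => Z.abs (D i false j))) <=? S * P * P)
    && (2 * Z.abs (g i true * g i true + g i false * g i false - S * S)
        <=? K * S)) (iota 0 n).

(** Twice the signed area of the triangle a, b, c, positive when it is counterclockwise. *)
Definition zcross (a b c : Z * Z) : Z :=
  (b.1 - a.1) * (c.2 - a.2) - (b.2 - a.2) * (c.1 - a.1).

(* How much [zcross] can change when every coordinate moves by at most tol. *)
Definition slack (a b c : Z * Z) : Z :=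
  2 * tol * (Z.abs (b.1 - a.1) + Z.abs (c.2 - a.2)
    + (Z.abs (b.2 - a.2) + Z.abs (c.1 - a.1))) + 8 * tol * tol.

Definition ccw (a b c : Z * Z) : bool := slack a b c <? zcross a b c.

Definition noncollinear (a b c : nat) : bool :=
  ccw (zpt a) (zpt b) (zpt c) || ccw (zpt a) (zpt c) (zpt b).

Definition same_side (a b u v : nat) : bool :=
  ccw (zpt a) (zpt b) (zpt u) && ccw (zpt a) (zpt b) (zpt v)
  || ccw (zpt a) (zpt u) (zpt b) && ccw (zpt a) (zpt v) (zpt b).

(** Edges with one common endpoint meet only there unless they are collinear. Edges without one are
    disjoint once the line through one of them leaves the other strictly on one side. The test
    [b == u] lets the two copies of the central edge pass. *)
Definition separated (e f : nat * nat) : bool :=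
  let: (a, b) := e in let: (u, v) := f in
  if a == u then (b == v) || noncollinear a b v
  else if a == v then (b == u) || noncollinear a b u
  else if b == u then noncollinear b a v
  else if b == v then noncollinear b a u
  else same_side a b u v || same_side u v a b.

(** * Certificates verified by computation *)

Lemma newton_check_link :
  newton_check 41 scale flex_scale flex_bound zgap zgap_flex.
Proof. by vm_compute. Qed.

(** As the solution satisfies |w_j| <= [flex_bound] / [flex_scale], this bounds the displacement of
    every coordinate by [tol]. *)
Lemma zflex_tol : all (fun v => all (fun d =>
    zsum 41 (fun j => Z.abs (zflex v d j)) * flex_bound <=? tol * flex_scale)
  [:: true; false]) (iota 0 54).
Proof. by vm_compute. Qed.

(** Two points each move by at most [tol] in a coordinate, so a gap above 2 * [tol] keeps them
    distinct. *)
Lemma zpt_apart : all (fun a => all (fun b => (a == b) || has (fun d =>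
    2 * tol <? Z.abs (crd d (zpt a) - crd d (zpt b))) [:: true; false])
  (iota 0 54)) (iota 0 54).
Proof. by vm_compute. Qed.

Lemma edges_separated : pairwise separated edges.
Proof. by vm_compute. Qed.

End IntegerData.

Lemma dart_lt54 : all (fun e => (e.1 < 54) && (e.2 < 54)) dart.
Proof. by vm_compute. Qed.

Lemma dart_swap : all (fun e => (e.2, e.1) \in dart) dart.
Proof. by vm_compute. Qed.

Lemma dart_irrefl : all (fun e => e.1 != e.2) dart.
Proof. by vm_compute. Qed.

Lemma dart_cubic :
  all (fun v => count (fun w => (v, w) \in dart) (iota 0 54) == 3) (iota 0 54).
Proof. by vm_compute. Qed.

(** Excludes triangles. *)
Lemma path2_open : all (fun p => (p.2, p.1.1) \notin dart) path2.
Proof. by vm_compute. Qed.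

(** Excludes quadrilaterals: distinct ends of a walk of length two determine its midpoint. *)
Lemma path2_unique : all (fun p => all (fun q =>
  [|| p.1.1 == p.2, p.1.1 != q.1.1, p.2 != q.2 | p.1.2 == q.1.2]) path2) path2.
Proof. by vm_compute. Qed.

(** * From integer certificates to an exact drawing *)

Section IntegersInR.
Local Open Scope ring_scope.
Variable R : realType.

(** Certificates are computed with the binary integers [Z]; this map carries them into the real
    field. *)
Definition zR (z : Z) : R := (int_of_Z z)%:~R.

Lemma zR0 : zR 0 = 0. Proof. by []. Qed.
Lemma zRpos p : zR (Zpos p) = (nat_of_pos p)%:R.
Proof. by rewrite /zR pmulrn; congr (_ %:~R); lia. Qed.
Lemma zRD x y : zR (Z.add x y) = zR x + zR y.
Proof. by rewrite -intrD; congr (_ %:~R); lia. Qed.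
Lemma zRN x : zR (Z.opp x) = - zR x.
Proof. by rewrite -mulrNz; congr (_ *~ _); lia. Qed.
Lemma zRB x y : zR (Z.sub x y) = zR x - zR y.
Proof. by rewrite -zRN -zRD. Qed.
Lemma zRM x y : zR (Z.mul x y) = zR x * zR y.
Proof. by rewrite -intrM; congr (_ %:~R); lia. Qed.
Lemma ler_zR x y : (zR x <= zR y) = Z.leb x y.
Proof. by rewrite ler_int; lia. Qed.
Lemma ltr_zR x y : (zR x < zR y) = Z.ltb x y.
Proof. by rewrite ltr_int; lia. Qed.
Lemma zR_norm x : zR (Z.abs x) = `|zR x|.
Proof. by rewrite -intr_norm; congr (_ %:~R); lia. Qed.
Lemma zR_sum n F : zR (zsum n F) = \sum_(j < n) zR (F j).
Proof.
rewrite /zsum -(big_mkord xpredT (fun j => zR (F j))) /index_iota subn0.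
by elim: (iota 0 n) => [|j s IHs]; rewrite ?big_nil// big_cons /= zRD IHs.
Qed.

Definition zRE := (zRD, zRB, zRN, zRM, zR_norm, zR_sum).

End IntegersInR.

Section ExactDrawing.
Local Open Scope ring_scope.

(** The normalised unknowns are rescaled by S / P, so that the integer tables [g] and [D] apply
    directly and lengths are measured in units of 1 / S. *)
Lemma newton_check_sound (R : realType) n (S P K : Z)
    (g : nat -> bool -> Z) (D : nat -> bool -> nat -> Z) :
    Z.ltb 0 S -> Z.ltb 0 P -> Z.leb 0 K -> newton_check n S P K g D ->
  exists2 w : 'I_n -> R, (forall j, `|w j| * zR R P <= zR R K) &
    forall i : 'I_n,
      \sum_d (zR R (g i d) + \sum_(j < n) zR R (D i d j) * w j) ^+ 2 = zR R S ^+ 2.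
Proof.
rewrite -(ltr_zR R) -(ltr_zR R) -(ler_zR R) zR0 => S0 P0 K0 /allP check.
have Sn0 := lt0r_neq0 S0; have Pn0 := lt0r_neq0 P0.
have /all_and2[contr init] (i : 'I_n) :=
  andP (check i (etrans (mem_iota 0 n i) (ltn_ord i))).
have q01 : 0 <= (2^-1 : R) < 1 by apply/andP; split; lra.
have r0 : 0 <= zR R K / zR R S by rewrite divr_ge0// ltW.
have [||u u_le uP] := @sum_sqr_system_solvable R n bool
  (fun (i : 'I_n) d => zR R (g i d) / zR R S)
  (fun i d (j : 'I_n) => zR R (D i d j) / zR R P) _ _ q01 r0.
- move=> i; have {contr} := contr i; rewrite -(ler_zR R) !zRE !zRpos.
  under eq_bigr do rewrite zR_norm !zRE zRpos.
  under [X in _ + _ * (X * _ + _) <= _ -> _]eq_bigr do rewrite zR_norm.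
  under [X in _ + _ * (_ * X + _) <= _ -> _]eq_bigr do rewrite zR_norm.
  under [X in _ + _ * (_ + X * _) <= _ -> _]eq_bigr do rewrite zR_norm.
  under [X in _ + _ * (_ + _ * X) <= _ -> _]eq_bigr do rewrite zR_norm.
  move=> contr.
  have normV (d : bool) : \sum_(j < n) `|zR R (D i d j) / zR R P| =
      (\sum_(j < n) `|zR R (D i d j)|) / zR R P.
    rewrite mulr_suml; apply: eq_bigr => j _.
    by rewrite normrM normfV (gtr0_norm P0).
  rewrite big_bool /= !normV.
  set X := \sum_(j < n) _ in contr.
  set Y1 := \sum_(j < n) `|zR R (D i true j)| in contr *.
  set Y0 := \sum_(j < n) `|zR R (D i false j)| in contr *.
  have -> : \sum_(j < n) `|(i == j)%:R -
        \sum_d 2 * (zR R (g i d) / zR R S) * (zR R (D i d j) / zR R P)|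
      = X / (zR R S * zR R P).
    rewrite /X mulr_suml; apply: eq_bigr => j _.
    rewrite -[zR R S * _]gtr0_norm ?mulr_gt0// -normfV -normrM; congr `|_|.
    rewrite big_bool /= -val_eqE /=.
    by case: (_ == _ :> nat); rewrite ?zRM ?zR0 /=; field; exact/andP.
  (* This factor clears the denominators of the contraction condition for q = 1/2 and recovers the
     integer inequality. *)
  rewrite -(ler_pM2r (x := 2 * zR R S * zR R P * zR R P)) ?mulr_gt0//.
  move: contr => /=; congr (_ <= _); field; by rewrite ?Sn0 ?Pn0.
- move=> i; have {init} := init i; rewrite -(ler_zR R) !zRE !zRpos big_bool /= => init.
  have -> : (zR R (g i true) / zR R S) ^+ 2 + (zR R (g i false) / zR R S) ^+ 2 - 1
      = (zR R (g i true) * zR R (g i true) + zR R (g i false) * zR R (g i false)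
         - zR R S * zR R S) / (zR R S) ^+ 2 by field.
  rewrite normrM normfV (gtr0_norm (exprn_gt0 _ S0)) ler_pdivrMr ?exprn_gt0//.
  have -> : (1 - 2^-1) * (zR R K / zR R S) * zR R S ^+ 2
      = 2^-1 * (zR R K * zR R S) by field.
  by lra.
exists (fun j => u j * zR R S / zR R P) => [j|i].
  rewrite normrM normfV (gtr0_norm P0) mulfVK// normrM (gtr0_norm S0).
  by rewrite -ler_pdivlMr.
have {}uP := uP i; rewrite -[RHS]mul1r -uP mulr_suml; apply: eq_bigr => d _.
rewrite -exprMn mulrDl mulfVK// mulr_suml; congr ((_ + _) ^+ 2).
by apply: eq_bigr => j _; field.
Qed.

(** * Orientation and intersection of segments *)

Section Segments.
Variable R : realType.
Implicit Types a b c u v w z : 'rV[R]_2.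

Definition vcross a b c : R :=
  (b 0 0 - a 0 0) * (c 0 1 - a 0 1) - (b 0 1 - a 0 1) * (c 0 0 - a 0 0).

Lemma vcross_swap a b c : vcross a c b = - vcross a b c.
Proof. by rewrite /vcross; ring. Qed.

Lemma in_segment_sym a b z : in_segment a b z -> in_segment b a z.
Proof.
case=> t /andP[t0 t1] ->; exists (1 - t); first by apply/andP; split; lra.
by rewrite addrC; congr (_ *: _ + _); ring.
Qed.

Lemma in_segment_left a b : in_segment a b a.
Proof. by exists 0; rewrite ?lexx ?ler01// subr0 scale1r scale0r addr0. Qed.

Lemma vcross_convex a b u v (t : R) :
  vcross a b ((1 - t) *: u + t *: v) = (1 - t) * vcross a b u + t * vcross a b v.
Proof. by rewrite /vcross !mxE; ring. Qed.

Lemma vcross_in_segment a b z : in_segment a b z -> vcross a b z = 0.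
Proof. by case=> t _ ->; rewrite vcross_convex /vcross; ring. Qed.

(** [vcross a b] is affine in its last argument: it vanishes on the segment from a to b and keeps a
    strict sign on the one from u to v. *)
Lemma same_side_disjoint a b u v z :
    0 < vcross a b u /\ 0 < vcross a b v \/ vcross a b u < 0 /\ vcross a b v < 0 ->
  in_segment a b z -> in_segment u v z -> False.
Proof.
move=> side /vcross_in_segment + [t /andP[t0 t1] zE].
by rewrite zE vcross_convex; case: side => -[]; nra.
Qed.

(** For z at parameter t on the segment from w to a, [vcross w b z] equals t times the nonzero
    [vcross w b a]. It vanishes when z is also on the segment from w to b, so t = 0. *)
Lemma noncollinear_meet w a b z :
  vcross w a b != 0 -> in_segment w a z -> in_segment w b z -> z = w.
Proof.
move=> nc [t _ ->] /vcross_in_segment.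
rewrite vcross_convex (_ : vcross w b w = 0); last by rewrite /vcross; ring.
rewrite mulr0 add0r vcross_swap => /eqP; rewrite mulf_eq0 oppr_eq0 (negbTE nc).
by rewrite orbF => /eqP ->; rewrite subr0 scale1r scale0r addr0.
Qed.

End Segments.

Lemma pairwise_index (T : eqType) (r : rel T) (s : seq T) (x y : T) :
  pairwise r s -> x \in s -> y \in s -> (index x s < index y s)%N -> r x y.
Proof.
move=> /(pairwiseP x) r_s xs ys /r_s; rewrite !inE !index_mem !nth_index//.
exact.
Qed.

(** * The exact placement and its crossings *)

Section Placement.
Variable R : realType.

(** The points are the approximate ones displaced by [flex] along the solution of the system. The
    system only has equations for [link]; the displaced points remain symmetric about the origin,
    which gives the lengths of the antipodal edges. *)
Lemma flexed_placement : exists y : nat -> bool -> R,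
  (forall v d, (v < 54)%N -> `|y v d - zR R (crd d (zpt v))| <= zR R tol) /\
  (forall e, e \in dart -> \sum_d (y e.1 d - y e.2 d) ^+ 2 = zR R scale ^+ 2).
Proof.
have [//|//|//|w w_le wP] := newton_check_sound R _ _ _ newton_check_link.
pose y v d := zR R (crd d (zpt v)) + \sum_(j < 41) zR R (zflex v d j) * w j.
exists y; split=> [v d v54|].
  rewrite /y addrC addKr.
  have P0 : 0 < zR R flex_scale by rewrite -(zR0 R) ltr_zR.
  have /allP/(_ v) := zflex_tol; rewrite mem_iota => /(_ v54)/allP/(_ d).
  have -> : d \in [:: true; false] by case: (d).
  move=> /(_ isT); rewrite -(ler_zR R) !zRM zR_sum => tolP.
  rewrite -(ler_pM2r P0); apply: le_trans tolP.
  rewrite -ler_pdivlMr// (le_trans (ler_norm_sum _ _ _))// !mulr_suml.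
  rewrite ler_sum// => j _.
  by rewrite zR_norm normrM -mulrA ler_wpM2l// ler_pdivlMr.
have y_anti v d : (v < 54)%N -> y (antipode v) d = - y v d.
  rewrite /y /antipode /zpt /zflex opprD -sumrN => v54.
  have [v27|v27] := ltnP v 27.
    have -> : (v + 27 < 27)%N = false by lia.
    rewrite addnK; congr (_ + _); last by apply: eq_bigr => j _; rewrite zRN mulNr.
    by case: (nth _ _ _) => ? ?; case: d; rewrite /= zRN.
  have -> : (v - 27 < 27)%N by lia.
  congr (_ + _); last by apply: eq_bigr => j _; rewrite zRN mulNr opprK.
  by case: (nth _ _ _) => ? ?; case: d; rewrite /= zRN opprK.
have linkP e : e \in link -> \sum_d (y e.1 d - y e.2 d) ^+ 2 = zR R scale ^+ 2.
  move=> /(nthP (0, 0)%N)[i i41 <-]; rewrite -(wP (Ordinal i41)).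
  apply: eq_bigr => d _; congr (_ ^+ 2); rewrite /zgap zRB /y opprD addrACA.
  congr (_ + _); rewrite -sumrB; apply: eq_bigr => j _.
  by rewrite /zgap_flex zRB mulrBl.
have edgeP e : e \in edges -> \sum_d (y e.1 d - y e.2 d) ^+ 2 = zR R scale ^+ 2.
  rewrite mem_cat => /orP[/linkP//|/mapP[f fl ->]] /=.
  have /andP[f1 f2] : (f.1 < 54)%N && (f.2 < 54)%N.
    by apply: (allP dart_lt54); rewrite !mem_cat fl.
  rewrite -(linkP _ fl); apply: eq_bigr => d _.
  by rewrite !y_anti//; ring.
move=> e; rewrite mem_cat => /orP[/edgeP//|/mapP[f fl ->]] /=.
by rewrite -(edgeP _ fl); apply: eq_bigr => d _; rewrite -opprB sqrrN.
Qed.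

(** The source of [slack]: each of the two products in [zcross] is perturbed with t = 2 * [tol],
    whence the term 8 * [tol] ^ 2. *)
Lemma mul_perturb (x y x0 y0 t : R) : `|x - x0| <= t -> `|y - y0| <= t ->
  `|x * y - x0 * y0| <= t * (`|x0| + `|y0|) + t ^+ 2.
Proof.
move=> xt yt.
have -> : x * y - x0 * y0 =
    (x0 * (y - y0) + (x - x0) * y0) + (x - x0) * (y - y0) by ring.
have t0 : 0 <= t := le_trans (normr_ge0 _) xt.
rewrite (le_trans (ler_normD _ _))// lerD//; last first.
  by rewrite normrM expr2 ler_pM.
rewrite (le_trans (ler_normD _ _))// !normrM mulrDr lerD//.
  by rewrite mulrC ler_wpM2r.
by rewrite ler_wpM2r.
Qed.

Variable y : nat -> bool -> R.
Hypothesis y_near :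
  forall v d, (v < 54)%N -> `|y v d - zR R (crd d (zpt v))| <= zR R tol.

Definition place (v : nat) : 'rV[R]_2 := \row_d (y v (d == 1) / zR R scale).

Let S0 : 0 < zR R scale. Proof. by rewrite -(zR0 R) ltr_zR. Qed.

Lemma gap_near a b d : (a < 54)%N -> (b < 54)%N ->
  `|y b d - y a d - (zR R (crd d (zpt b)) - zR R (crd d (zpt a)))| <= 2 * zR R tol.
Proof.
move=> a54 b54.
have -> : y b d - y a d - (zR R (crd d (zpt b)) - zR R (crd d (zpt a))) =
  (y b d - zR R (crd d (zpt b))) - (y a d - zR R (crd d (zpt a))) by ring.
by rewrite (le_trans (ler_normB _ _))// mulr2n mulrDl mul1r lerD// y_near.
Qed.

Lemma ccw_sound a b c : (a < 54)%N -> (b < 54)%N -> (c < 54)%N ->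
  ccw (zpt a) (zpt b) (zpt c) -> 0 < vcross (place a) (place b) (place c).
Proof.
move=> a54 b54 c54; rewrite /ccw -(ltr_zR R) /slack /zcross !zRE.
rewrite (zRpos R 2) (zRpos R 8) /= => lt.
(* One-sided bounds suffice: the subtracted product is bounded from above here, the other one from
   below next. *)
have /= := ler_normlW
  (mul_perturb (gap_near true a54 b54) (gap_near false a54 c54)).
have := mul_perturb (gap_near false a54 b54) (gap_near true a54 c54).
rewrite distrC => /ler_normlW /= h1 h2; rewrite /vcross !mxE /=.
(* Takes the positive factor 1 / [scale] ^ 2 out of the determinant. *)
rewrite -!mulrBl mulrACA [X in _ - X]mulrACA -mulrBl.
rewrite mulr_gt0 ?mulr_gt0 ?invr_gt0//.
by rewrite subr_gt0 eqxx (_ : (0 == 1 :> 'I_2) = false)//; lra.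
Qed.

(** Coincidence is allowed up to reversal, which makes the relation stable under exchanging the
    edges and reversing either one. Checking the pairs of [edges] in list order then covers all
    pairs of darts. *)
Definition clean_meet (e f : nat * nat) : Prop := forall z,
  in_segment (place e.1) (place e.2) z -> in_segment (place f.1) (place f.2) z ->
  (e = f \/ e = (f.2, f.1)) \/
  exists2 w, (w \in [:: e.1; e.2]) && (w \in [:: f.1; f.2]) & z = place w.

Lemma clean_meet_sym e f : clean_meet e f -> clean_meet f e.
Proof.
move=> ef z zf ze; have [[->|->]|[w we ->]] := ef z ze zf.
- by left; left.
- by left; right; rewrite -surjective_pairing.
- by right; exists w; rewrite // andbC.
Qed.

Lemma clean_meet_swap e f : clean_meet e f -> clean_meet (e.2, e.1) f.
Proof.
move=> ef z /in_segment_sym ze zf; have [[->|->]|[w we ->]] := ef z ze zf.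
- by left; right.
- by left; left; rewrite -surjective_pairing.
- by right; exists w => //; move: we; rewrite !inE [(w == e.1) || _]orbC.
Qed.

Lemma noncollinear_sound w a b z : (w < 54)%N -> (a < 54)%N -> (b < 54)%N ->
  noncollinear w a b -> in_segment (place w) (place a) z ->
  in_segment (place w) (place b) z -> z = place w.
Proof.
move=> w54 a54 b54 nc; apply: noncollinear_meet.
have /orP[/ccw_sound|/ccw_sound] := nc; first by move=> c; rewrite gt_eqF ?c.
by rewrite vcross_swap oppr_gt0 => c; rewrite lt_eqF ?c.
Qed.

Lemma same_side_sound a b u v z :
  (a < 54)%N -> (b < 54)%N -> (u < 54)%N -> (v < 54)%N ->
  same_side a b u v -> in_segment (place a) (place b) z ->
  in_segment (place u) (place v) z -> False.
Proof.
move=> a54 b54 u54 v54 side; apply: same_side_disjoint.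
case/orP: side => /andP[/ccw_sound c1 /ccw_sound c2]; [left|right].
  by split; [exact: c1|exact: c2].
by rewrite -!oppr_gt0 -!vcross_swap; split; [exact: c1|exact: c2].
Qed.

Lemma separated_sound e f : (e.1 < 54)%N && (e.2 < 54)%N ->
  (f.1 < 54)%N && (f.2 < 54)%N -> separated e f -> clean_meet e f.
Proof.
case: e f => [a b] [u v] /= /andP[a54 b54] /andP[u54 v54] sep z /= ze zf.
move: sep; have [au|_] := eqVneq a u.
  subst u; have [->|_] := eqVneq b v; first by left; left.
  move=> /= nc; right; exists a; rewrite ?inE ?eqxx//.
  exact: noncollinear_sound nc ze zf.
have [av|_] := eqVneq a v.
  subst v; have [->|_] := eqVneq b u; first by left; right.
  move=> /= nc; right; exists a; rewrite ?inE ?eqxx ?orbT//.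
  exact: noncollinear_sound nc ze (in_segment_sym zf).
have [bu|_] := eqVneq b u.
  subst u => nc; right; exists b; rewrite ?inE ?eqxx ?orbT//.
  exact: noncollinear_sound nc (in_segment_sym ze) zf.
have [bv|_] := eqVneq b v.
  subst v => nc; right; exists b; rewrite ?inE ?eqxx ?orbT//.
  exact: noncollinear_sound nc (in_segment_sym ze) (in_segment_sym zf).
by case/orP => s; [case: (same_side_sound _ _ _ _ s ze zf)
  |case: (same_side_sound _ _ _ _ s zf ze)].
Qed.

Lemma dart_clean_meet e f : e \in dart -> f \in dart -> clean_meet e f.
Proof.
have ltP g : g \in edges -> (g.1 < 54)%N && (g.2 < 54)%N.
  by move=> gE; apply: (allP dart_lt54); rewrite mem_cat gE.
have edgesP g h : g \in edges -> h \in edges -> clean_meet g h.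
  move=> gE hE; have sep := pairwise_index edges_separated.
  have [gh|gh|gh] := ltngtP (index g edges) (index h edges).
  - exact: separated_sound (ltP g gE) (ltP h hE) (sep _ _ gE hE gh).
  - apply: clean_meet_sym.
    exact: separated_sound (ltP h hE) (ltP g gE) (sep _ _ hE gE gh).
  - by have -> := index_inj g gE hE gh => z _ _; left; left.
have dartP g h : g \in edges -> h \in dart -> clean_meet g h.
  move=> gE; rewrite mem_cat => /orP[|/mapP[k kE ->]]; first exact: edgesP.
  by apply/clean_meet_sym/clean_meet_swap/edgesP.
move=> + fD; rewrite mem_cat => /orP[eE|/mapP[k kE ->]]; first exact: dartP.
exact/clean_meet_swap/dartP.
Qed.

Lemma place_inj a b : (a < 54)%N -> (b < 54)%N -> place a = place b -> a = b.
Proof.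
move=> a54 b54 ab; have /allP/(_ a) := zpt_apart; rewrite mem_iota.
move=> /(_ a54)/allP/(_ b); rewrite mem_iota => /(_ b54)/orP[/eqP//|/hasP[d _]].
rewrite -(ltr_zR R) !zRE (zRpos R 2) /= => apart.
suff yab : y a d = y b d.
  by have := gap_near d b54 a54; rewrite yab subrr sub0r normrN leNgt apart.
have := congr1 (fun x : 'rV[R]_2 => x 0 (if d then 1 else 0)) ab.
rewrite !mxE => /(mulIf (invr_neq0 (lt0r_neq0 S0))).
by case: d {apart}; rewrite ?eqxx.
Qed.

End Placement.

End ExactDrawing.

(** * The matchstick graph *)

Definition adjacent : rel 'I_54 := fun x y => (val x, val y) \in dart.

Lemma card_ord_count n (P : pred nat) : #|[set x : 'I_n | P x]| = count P (iota 0 n).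
Proof. by rewrite cardsE cardE -val_enum_ord count_map -size_filter enumT. Qed.

Lemma adjacent_simple : simple_graph adjacent.
Proof.
split=> [x y|x].
  by apply/idP/idP => /(allP dart_swap).
by apply/negbTE/negP => /(allP dart_irrefl) /=; rewrite eqxx.
Qed.

Lemma adjacent_cubic : regular adjacent 3.
Proof.
move=> x; rewrite /degree (card_ord_count _ (fun w => (val x, w) \in dart)).
by apply/eqP/(allP dart_cubic); rewrite mem_iota ltn_ord.
Qed.

Lemma adjacent_path2 x y z : adjacent x y -> adjacent y z ->
  (val x, val y, val z) \in path2.
Proof.
move=> xy yz; apply/allpairsPdep; exists (val x, val y), (val y, val z).
by split=> //; rewrite mem_filter eqxx.
Qed.

Lemma adjacent_girth : has_girth adjacent 5.
Proof.
split.
  (* The pentagon 0, 1, 4, 6, 2. *)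
  by exists [:: @Ordinal 54 0 isT; @Ordinal 54 1 isT; @Ordinal 54 4 isT;
    @Ordinal 54 6 isT; @Ordinal 54 2 isT].
move=> c [/andP[+ +] +]; case: c => [|x [|y [|z [|w [|v c]]]]] //=.
  move=> /and4P[xy yz zx _] _ _.
  by have /negP[] := allP path2_open _ (adjacent_path2 xy yz).
(* In a quadrilateral x, y, z, w both y and w are midpoints of walks from x to z, so they would
   coincide. *)
move=> /and5P[xy yz zw wx _]; rewrite !inE !negb_or -!andbA.
move=> /and5P[_ xz _ _ /andP[yw _]] _.
have [sym _] := adjacent_simple.
have wP : (val x, val w, val z) \in path2 by apply: adjacent_path2; rewrite sym.
have /allP/(_ _ wP) := allP path2_unique _ (adjacent_path2 xy yz).
by rewrite /= !eqxx !val_eqE (negbTE xz) (negbTE yw).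
Qed.

Section Drawing.
Local Open Scope ring_scope.

Lemma adjacent_drawing (R : realType) :
  exists p : 'I_54 -> 'rV[R]_2, matchstick_drawing adjacent p.
Proof.
have [y [y_near len]] := flexed_placement R.
pose p (x : 'I_54) := place y (val x).
have p_inj : injective p.
  by move=> a b /(place_inj y_near (ltn_ord a) (ltn_ord b)) /val_inj.
have meet a b u v : adjacent a b -> adjacent u v -> [set a; b] != [set u; v] ->
    forall z, in_segment (p a) (p b) z -> in_segment (p u) (p v) z ->
    exists2 w, w \in [set a; b] :&: [set u; v] & z = p w.
  move=> ab uv neq z zab zuv.
  have [[[/val_inj au /val_inj bv]|[/val_inj av /val_inj bu]]|] :=
    dart_clean_meet y_near ab uv zab zuv.
  - by rewrite au bv eqxx in neq.
  - by rewrite av bu finset.setUC eqxx in neq.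
  move=> [w /= /andP[wab wuv] ->].
  have w54 : (w < 54)%N by move: wab; rewrite !inE => /orP[]/eqP->.
  exists (Ordinal w54) => //; rewrite !inE in wab wuv.
  by rewrite !inE -!val_eqE /= wab.
exists p; split=> // [a b ab|a b w ab wab].
  rewrite /edist -[RHS]sqrtr1; congr Num.sqrt.
  have S0 : zR R scale != 0 by rewrite gt_eqF// -(zR0 R) ltr_zR.
  apply: (mulIf (expf_neq0 2 S0)); rewrite mul1r -[RHS](len _ ab).
  by rewrite big_bool big_ord_recl big_ord1 /p /place !mxE /=; field.
(* A vertex w lying on the edge from a to b is handled through some edge at w, which exists by
   regularity. Either the two edges coincide, or they meet at [p w] only in a common endpoint, which
   must be w. *)
have [w' ww'] : exists w', adjacent w w'.
  have : (0 < degree adjacent w)%N by rewrite adjacent_cubic.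
  by case/card_gt0P => w'; rewrite inE; exists w'.
have [->|neq] := eqVneq [set a; b] [set w; w']; first by rewrite !inE eqxx.
have [w'' + /p_inj ->] := meet _ _ _ _ ab ww' neq _ wab (in_segment_left _ _).
by rewrite inE => /andP[].
Qed.

End Drawing.

Theorem mainTheorem1 (R : realType) :
  exists (T : finType) (e : rel T),
    [/\ matchstick_graph R e, regular e 3, has_girth e 5 & #|T| = 54].
Proof.
exists 'I_54, adjacent; split.
- exact: (conj adjacent_simple (adjacent_drawing R)).
- exact: adjacent_cubic.
- exact: adjacent_girth.
- exact: card_ord.
Qed.
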